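(* For every integer $n\ge 3$, $dyn_2(C_n\Box K_n)=\left\lfloor \dfrac{n}{2}+1\right\rfloor$.
   Context: $C_n$ is the cycle and $K_n$ the complete graph on $n$ vertices; $G\Box H$ is the Cartesian product (vertex set $V(G)\times V(H)$, $(u,v)\sim(u',v')$ iff $u=u'$ and $vv'\in E(H)$, or $v=v'$ and $uu'\in E(G)$). For a graph $G$ with threshold assignment $\tau:V(G)\to\mathbb{N}$, a set $D\subseteq V(G)$ is a $\tau$-dynamic monopoly if $V(G)$ can be partitioned into sets $D_0=D,D_1,\dots,D_k$ such that each vertex $v\in D_{i+1}$ has at least $\tau(v)$ neighbors in $D_0\cup\dots\cup D_i$ (equivalently, starting from $D$ and repeatedly adding vertices $u$ having at least $\tau(u)$ neighbors in the current set yields all of $V(G)$). $dyn_\tau(G)$ is the minimum size of a $\tau$-dynamic monopoly, written $dyn_t(G)$ when $\tau\equiv t$. *)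

(* Defs.v *)
From mathcomp Require Import all_boot.
From mathcomp Require Import boolp.

Set Implicit Arguments.
Unset Strict Implicit.
Unset Printing Implicit Defensive.

(* A graph on a finType T is its adjacency relation e : rel T. *)

(* ordS is the cyclic successor i.+1 %% n.  This is the simple graph C_n only
   for n >= 3: there is a loop at n = 1 and a single edge at n = 2. *)
Definition cycle_graph (n : nat) : rel 'I_n :=
  [rel i j | (j == ordS i) || (i == ordS j)].

Definition complete_graph (n : nat) : rel 'I_n := [rel i j | i != j].

Definition cart_prod (S T : finType) (e : rel S) (f : rel T) : rel (S * T) :=
  [rel x y | (x.1 == y.1) && f x.2 y.2 || (x.2 == y.2) && e x.1 y.1].

(* The parts P 0, ..., P k are the D_0, ..., D_k; the values of P beyond k are
   irrelevant.  Empty parts are allowed: D may be empty, and an empty later part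
   can be deleted without affecting the other conditions. *)
Definition dynamic_monopoly (T : finType) (e : rel T) (tau : T -> nat)
    (D : {set T}) : Prop :=
  exists (k : nat) (P : nat -> {set T}),
    [/\ P 0 = D,
        \bigcup_(i < k.+1) P i = [set: T],
        forall i j, i <= k -> j <= k -> i != j -> [disjoint P i & P j]
      & forall i v, i < k -> v \in P i.+1 ->
          tau v <= #|[set u in \bigcup_(j < i.+1) P j | e v u]|].

Lemma dynamic_monopolyT (T : finType) (e : rel T) (tau : T -> nat) :
  dynamic_monopoly e tau [set: T].
Proof.
exists 0, (fun=> [set: T]); split=> //; first by rewrite big_ord1.
by move=> i j; rewrite !leqn0 => /eqP-> /eqP->.
Qed.

(* The default [set: T] of the argmin is itself a dynamic monopoly, so this is
   the true minimum, see dynP. *)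
Definition dyn (T : finType) (e : rel T) (tau : T -> nat) : nat :=
  #|[arg min_(D < [set: T] | `[< dynamic_monopoly e tau D >]) #|D|]|.

Lemma dynP (T : finType) (e : rel T) (tau : T -> nat) :
  (exists2 D, dynamic_monopoly e tau D & #|D| = dyn e tau) /\
  (forall D, dynamic_monopoly e tau D -> dyn e tau <= #|D|).
Proof.
rewrite /dyn; case: arg_minnP => [|D /asboolP DD minD].
  exact/asboolP/dynamic_monopolyT.
by split=> [|D' /asboolP]; [exists D | apply: minD].
Qed.

Lemma cycle_graph_sym n : symmetric (@cycle_graph n).
Proof. by move=> i j; rewrite /cycle_graph /= orbC. Qed.

Lemma cycle_graph_irr n : 1 < n -> irreflexive (@cycle_graph n).
Proof.
move=> n1 i; rewrite /cycle_graph /= orbb -val_eqE /=; apply/negbTE/eqP.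
case: (ltnP i.+1 n) => [lt|ge]; first by rewrite modn_small // => /n_Sn.
have -> : i.+1 = n by apply/eqP; rewrite eqn_leq ltn_ord.
by rewrite modnn => i0; move: ge; rewrite i0 leqNgt n1.
Qed.

Lemma complete_graph_sym n : symmetric (@complete_graph n).
Proof. by move=> i j; rewrite /complete_graph /= eq_sym. Qed.

Lemma complete_graph_irr n : irreflexive (@complete_graph n).
Proof. by move=> i; rewrite /complete_graph /= eqxx. Qed.

Lemma cart_prod_sym (S T : finType) (e : rel S) (f : rel T) :
  symmetric e -> symmetric f -> symmetric (cart_prod e f).
Proof.
by move=> es fs x y; rewrite /cart_prod /= es fs ![_ == y.1]eq_sym ![_ == y.2]eq_sym.
Qed.

Lemma cart_prod_irr (S T : finType) (e : rel S) (f : rel T) :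
  irreflexive e -> irreflexive f -> irreflexive (cart_prod e f).
Proof. by move=> ei fi x; rewrite /cart_prod /= ei fi !andbF. Qed.

(* Main.v *)
Require Import Defs.
From mathcomp Require Import all_boot.
From mathcomp Require Import zify.

(** A set [D] is a dynamic monopoly iff the only superset of [D] closed under
    the spreading rule is the whole vertex set.  Call the copies of [K_n] rows.

    Upper bound: seed one vertex of row [0] in one column, and every odd row in
    a second column.  Row [0] fills up; a full row fills the next row as soon as
    that one contains a seed, and a full row together with a seed two rows
    further fills the row in between.

    Lower bound: two consecutive rows without seeds are never entered, so
    consecutive rows contain together at least one seed, whence [n <= 2 #|D|].
    If [n = 2 #|D|] then rows without seeds alternate with rows containing
    exactly one seed.  Adding to [D] the vertices whose two neighbours in
    their column are seeds then gives a closed set with at most one vertex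
    in each row. *)

Set Implicit Arguments.
Unset Strict Implicit.
Unset Printing Implicit Defensive.

(** * Dynamic monopolies in terms of closed sets, for arbitrary thresholds *)

Section ClosedSets.
Variables (T : finType) (e : rel T) (tau : T -> nat).

Definition spread_closed (Y : {set T}) : Prop :=
  forall v, tau v <= #|[set u in Y | e v u]| -> v \in Y.

(** By induction every stage stays inside [Y]. Hence a proper closed superset of [D] shows that [D]
    is no dynamic monopoly; both lower-bound arguments have this form. *)
Lemma dynamic_monopoly_closedT (D Y : {set T}) :
  dynamic_monopoly e tau D -> D \subset Y -> spread_closed Y -> Y = [set: T].
Proof.
case=> k [P [P0 PT _ Pspread]] sDY clY.
have sub i : i <= k -> \bigcup_(j < i.+1) P j \subset Y.
  elim: i => [|i IH] ik; first by rewrite big_ord1 P0.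
  rewrite big_ord_recr /= subUset IH ?(ltnW ik) //=.
  apply/subsetP=> v /(Pspread i v ik) lev; apply: clY.
  apply: leq_trans lev (subset_leq_card _).
  apply/subsetP=> u; rewrite !inE => /andP[uP ->]; rewrite andbT.
  exact: subsetP (IH (ltnW ik)) u uP.
by apply/eqP; rewrite -subTset -PT; apply: sub.
Qed.

Definition spread (A : {set T}) : {set T} :=
  A :|: [set v | tau v <= #|[set u in A | e v u]|].

Lemma iter_spread_sub (D : {set T}) i j :
  i <= j -> iter i spread D \subset iter j spread D.
Proof.
elim: j => [|j IH]; first by rewrite leqn0 => /eqP->.
rewrite leq_eqVlt => /predU1P[-> //|ij].
exact: subset_trans (IH ij) (subsetUl _ _).
Qed.

Lemma iter_spread_fixed (D : {set T}) :
  exists k, spread (iter k spread D) = iter k spread D.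
Proof.
(* Until a fixed point appears each round adds a vertex, which can happen at most [#|T|] times. *)
have H m : (exists k, spread (iter k spread D) = iter k spread D)
           \/ m <= #|iter m spread D|.
  elim: m => [|m [|IH]]; [by right|by left|].
  have [fix_m|nfix] := eqVneq (spread (iter m spread D)) (iter m spread D).
    by left; exists m.
  right; apply: leq_ltn_trans IH _; apply: proper_card.
  by rewrite properEneq eq_sym nfix subsetUl.
by case: (H #|T|.+1) => // /leq_trans /(_ (max_card _)); rewrite ltnn.
Qed.

Lemma closedT_dynamic_monopoly (D : {set T}) :
  (forall Y : {set T}, D \subset Y -> spread_closed Y -> Y = [set: T]) ->
  dynamic_monopoly e tau D.
Proof.
move=> DT; have [k fixk] := iter_spread_fixed D.
(* The parts are the increments of the growing sets [A i]; the stationary set [A k] is closed and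
   contains [D], so it is everything. *)
pose A i := iter i spread D.
pose P i := if i is i'.+1 then A i'.+1 :\: A i' else D.
have UP i : \bigcup_(j < i.+1) P j = A i.
  elim: i => [|i IH]; first by rewrite big_ord1.
  rewrite big_ord_recr /= IH; apply/setP=> v; rewrite !inE.
  by case: (v \in A i).
have disP i j : i < j -> [disjoint P i & P j].
  case: j => // j ij; rewrite disjoint_sym disjoints_subset.
  apply/subsetP=> v /setDP[_ vAj]; rewrite inE; apply: contra vAj => vP.
  have {}ij : i <= j by [].
  apply: (subsetP (iter_spread_sub D ij)).
  by case: i vP {ij} => [//|i /setDP[]].
exists k, P; split=> //.
- rewrite UP; apply: DT => [|v lev]; first exact: (iter_spread_sub D (leq0n k)).
  by rewrite /A -fixk !inE lev orbT.
- by move=> i j _ _; rewrite neq_ltn => /orP[/disP //|/disP]; rewrite disjoint_sym.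
by move=> i v _; rewrite UP /= !inE => /andP[/negbTE->].
Qed.

End ClosedSets.

Section CycleTimesComplete.
Variables n m : nat.
Local Notation V := ('I_n * 'I_m)%type.
Local Notation E := (cart_prod (@cycle_graph n) (@complete_graph m)).

Lemma cycle_complete_adjP (v u : V) :
  E v u -> [\/ u.1 = v.1 /\ u.2 != v.2, u = (ordS v.1, v.2)
             | u = (ord_pred v.1, v.2)].
Proof.
case: v u => [i j] [i' j'] /orP[] /andP[/= /eqP <-].
  by constructor 1; rewrite /= eq_sym.
by case/orP=> /eqP->; [constructor 2|constructor 3; rewrite ordSK].
Qed.

Lemma adj_row i j j' : j != j' -> E (i, j) (i, j').
Proof. by move=> jj'; rewrite /cart_prod /complete_graph /= eqxx jj'. Qed.

Lemma adj_ordS i j : E (i, j) (ordS i, j).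
Proof. by rewrite /cart_prod /cycle_graph /= !eqxx orbT. Qed.

Lemma adj_ord_pred i j : E (i, j) (ord_pred i, j).
Proof. by rewrite /cart_prod /cycle_graph /= !eqxx /= ord_predK eqxx !orbT. Qed.

(** * Lower bound: counting seeds by rows *)

Section LowerBound.
Variable D : {set V}.
Hypothesis monD : dynamic_monopoly E (fun=> 2) D.

Let r i := #|[set j | (i, j) \in D]|.

Lemma sum_row_seeds : \sum_i r i = #|D|.
Proof.
rewrite -sum1_card (eq_bigl (fun p : V => (p.1, p.2) \in D)); last by case.
rewrite -(pair_big_dep xpredT (fun i j => (i, j) \in D) (fun _ _ => 1)) /=.
by apply: eq_bigr => i _; rewrite sum1dep_card.
Qed.

Lemma row_seed0 i j : r i = 0 -> (i, j) \notin D.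
Proof. by move/eqP; rewrite cards_eq0 => /eqP/setP/(_ j); rewrite !inE => ->. Qed.

Lemma row_seed_uniq i j j' : r i <= 1 -> (i, j) \in D -> (i, j') \in D -> j = j'.
Proof. by move/card_le1_eqP=> H ij ij'; apply: H; rewrite inE. Qed.

(** A vertex in one of the two rows has at most one neighbour outside them, on the far side of its
    column, so the complement of two seedless rows is closed. *)
Lemma consecutive_rows_seeded i : 0 < m -> 0 < r i + r (ordS i).
Proof.
move=> m0; rewrite lt0n addn_eq0; apply/negP=> /andP[/eqP ri /eqP rSi].
pose Y : {set V} := [set v | (v.1 != i) && (v.1 != ordS i)].
have YT : Y = [set: V].
  apply: (dynamic_monopoly_closedT monD).
    apply/subsetP=> -[a b] abD; rewrite inE /=.
    apply/andP; split; apply: contraL abD => /eqP->; exact: row_seed0.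
  move=> [a b] /card_gt1P[u [w [uS wS]]]; apply: contraNT.
  rewrite inE /= negb_and !negbK => ai.
  move: uS wS; rewrite !inE => /andP[/andP[u1 u2] /cycle_complete_adjP /= Hu].
  move=> /andP[/andP[w1 w2] /cycle_complete_adjP /= Hw].
  case/orP: ai => /eqP ai; subst a.
  - case: Hu => [[u1E _]|uE|uE]; [by rewrite u1E eqxx in u1|
      by rewrite uE eqxx in u2|].
    case: Hw => [[w1E _]|wE|wE]; [by rewrite w1E eqxx in w1|
      by rewrite wE eqxx in w2|by rewrite uE wE].
  - case: Hu => [[u1E _]|uE|uE]; [by rewrite u1E eqxx in u2| |
      by rewrite uE /= ordSK eqxx in u1].
    case: Hw => [[w1E _]|wE|wE]; [by rewrite w1E eqxx in w2|by rewrite uE wE|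
      by rewrite wE /= ordSK eqxx in w1].
by have := in_setT (i, Ordinal m0); rewrite -YT inE /= eqxx.
Qed.

Lemma consecutive_rows_not_all1 :
  0 < n -> 1 < m -> ~ (forall i, r i + r (ordS i) = 1).
Proof.
move=> n0 m1 r1.
have rS i : r (ord_pred i) + r i = 1 by have := r1 (ord_pred i); rewrite ord_predK.
pose Y : {set V} := D :|: [set v | ((ord_pred v.1, v.2) \in D)
                                   && ((ordS v.1, v.2) \in D)].
have YE i j : ((i, j) \in Y) = ((i, j) \in D)
    || ((ord_pred i, j) \in D) && ((ordS i, j) \in D) by rewrite !inE.
(* In a seedless row, added vertices lie in the column of the only seed of the next row; a seeded
   row has a seedless next row, so nothing is added to it. *)
have uniqY i j j' : (i, j) \in Y -> (i, j') \in Y -> j = j'.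
  have [r1i rSi] := (r1 i, rS i).
  have ri : r i <= 1 by lia.
  rewrite !YE; have [r0|r_n0] := eqVneq (r i) 0.
    rewrite !(negbTE (row_seed0 _ r0)) /= => /andP[_ H] /andP[_ H'].
    by apply: row_seed_uniq H H'; lia.
  have r0 : r (ordS i) = 0 by lia.
  rewrite !(negbTE (row_seed0 _ r0)) !andbF !orbF; exact: row_seed_uniq.
(* A vertex of [Y] outside [D] has seeds as column neighbours, but [(i, j)] is not one. *)
have colD i i' j : (i, j) \notin Y -> i' = ordS i \/ i' = ord_pred i ->
    (i', j) \in Y -> (i', j) \in D /\ r i' = 1.
  rewrite YE negb_or => /andP[ijD _] Hi'; rewrite YE => /orP[i'D|].
    split=> //; have : r i' <= 1.
      by have := r1 i'; lia.
    have : r i' != 0 by apply: contraL i'D => /eqP/row_seed0->.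
    by lia.
  by case: Hi' => ->; rewrite ?ordSK ?ord_predK (negbTE ijD) ?andbF.
(* The seed [(i', j)] makes row [i] seedless, so [(i, j')] was added and [(i', j')] is a second seed
   of row [i']. *)
have mixed i j i' j' : (i, j) \notin Y -> j' != j -> (i, j') \in Y ->
    i' = ordS i \/ i' = ord_pred i -> (i', j) \in Y -> False.
  move=> ijY jj' ij'Y Hi' i'jY; have [i'D ri'] := colD _ _ _ ijY Hi' i'jY.
  have r0 : r i = 0 by case: Hi' ri' => ->; [have := r1 i|have := rS i]; lia.
  move: ij'Y; rewrite YE (negbTE (row_seed0 _ r0)) /= => /andP[Dp DS].
  case/negP: jj'; apply/eqP.
  by case: Hi' i'D ri' => -> i'D ri'; [apply: row_seed_uniq DS i'D|
    apply: row_seed_uniq Dp i'D]; rewrite ri'.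
have YT : Y = [set: V].
  apply: (dynamic_monopoly_closedT monD) (subsetUl _ _) _.
  move=> [i j] /card_gt1P[u [w [uS wS]]]; apply: contraNT => ijY.
  case: u w uS wS => [a b] [a' b']; rewrite !(in_set (fun _ => _ && _)).
  move=> /andP[uY /cycle_complete_adjP /= Hu] /andP[wY /cycle_complete_adjP /= Hw].
  have both : (ordS i, j) \in Y -> (ord_pred i, j) \in Y -> False.
    move=> /(colD _ _ _ ijY (or_introl erefl))[SD _].
    move=> /(colD _ _ _ ijY (or_intror erefl))[pD _].
    by move: ijY; rewrite YE SD pD orbT.
  case: Hu uY => [[-> bj]|[-> ->]|[-> ->]] uY;
    case: Hw wY => [[-> bj']|[-> ->]|[-> ->]] wY //.
  - by rewrite (uniqY _ _ _ uY wY).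
  - by case: (mixed _ _ _ _ ijY bj uY (or_introl erefl) wY).
  - by case: (mixed _ _ _ _ ijY bj uY (or_intror erefl) wY).
  - by case: (mixed _ _ _ _ ijY bj' wY (or_introl erefl) uY).
  - by case: (both uY wY).
  - by case: (mixed _ _ _ _ ijY bj' wY (or_intror erefl) uY).
  - by case: (both wY uY).
have := uniqY (Ordinal n0) (Ordinal (ltnW m1)) (Ordinal m1).
by rewrite YT !in_setT => /(_ isT isT) [].
Qed.

Lemma dynamic_monopoly_cycle_complete_card : 0 < n -> 1 < m -> n < 2 * #|D|.
Proof.
move=> n0 m1; rewrite ltnNge; apply/negP => leD.
have sumE : \sum_i (r i + r (ordS i)) = 2 * #|D|.
  rewrite big_split /= -(reindex_inj (h := @ordS n) (P := xpredT) (F := r)) /=.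
    by rewrite sum_row_seeds mul2n addnn.
  exact: can_inj (@ordSK n).
apply: consecutive_rows_not_all1 => // i; apply/eqP; rewrite eqn_leq.
rewrite consecutive_rows_seeded ?(ltnW m1) // andbT leqNgt; apply/negP=> ri.
(* All [n] summands are positive, so a single one above 1 pushes the sum beyond [n]. *)
suff: n < \sum_i (r i + r (ordS i)) by lia.
rewrite (bigD1 i) //= -[X in X < _]card_ord -sum1_card (bigD1 i) //=.
rewrite -addSn; apply: leq_add => //; apply: leq_sum => k _.
exact: consecutive_rows_seeded (ltnW m1).
Qed.

End LowerBound.
End CycleTimesComplete.

(** * Upper bound: an explicit dynamic monopoly *)

Section UpperBound.
Variables n m : nat.
Hypothesis n1 : 0 < n.
Variables c d : 'I_m.
Hypothesis cd : c != d.
Local Notation V := ('I_n.+1 * 'I_m)%type.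
Local Notation E := (cart_prod (@cycle_graph n.+1) (@complete_graph m)).

(** The rows are [0] to [n], so the indices [k] below [n.+1./2] give exactly the odd rows. *)
Definition odd_row_seeds : {set V} :=
  (ord0, c) |: [set (inord k.*2.+1, d) | k : 'I_(n.+1./2)].

Lemma card_odd_row_seeds : #|odd_row_seeds| <= n.+1./2 + 1.
Proof.
rewrite cardsU1 addnC leq_add ?leq_b1 //.
by apply: leq_trans (leq_imset_card _ _) _; rewrite card_ord.
Qed.

Lemma mem_odd_row_seeds i : odd i -> i <= n -> (inord i, d) \in odd_row_seeds.
Proof.
move=> oi lein; rewrite !inE; apply/orP; right; apply/imsetP.
have lt : i./2 < n.+1./2 by lia.
by exists (Ordinal lt) => //=; congr (inord _, _); lia.
Qed.

Lemma ordS_inord i : i < n -> ordS (inord i : 'I_n.+1) = inord i.+1.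
Proof.
move=> lt; apply: val_inj; rewrite /= !inordK ?modn_small //; lia.
Qed.

Lemma ord_pred_inordS i : i < n -> ord_pred (inord i.+1 : 'I_n.+1) = inord i.
Proof. by move=> lt; rewrite -ordS_inord // ordSK. Qed.

Lemma dynamic_monopoly_odd_row_seeds :
  dynamic_monopoly E (fun=> 2) odd_row_seeds.
Proof.
apply: closedT_dynamic_monopoly => Y sDY clY.
have two v u w : u \in Y -> w \in Y -> E v u -> E v w -> u != w -> v \in Y.
  move=> uY wY vu vw uw; apply: clY; apply/card_gt1P; exists u, w.
  by rewrite !inE uY wY vu vw.
have seed i : odd i -> i <= n -> (inord i, d) \in Y.
  by move=> oi lein; apply: subsetP sDY _ (mem_odd_row_seeds oi lein).
have row0 j : (inord 0, j) \in Y.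
  have i0 : inord 0 = ord0 :> 'I_n.+1 by apply: val_inj; rewrite /= inordK.
  have cY : (inord 0, c) \in Y.
    by apply: (subsetP sDY); rewrite i0 !inE eqxx.
  have dY : (inord 0, d) \in Y.
    apply: (two _ _ _ cY (seed 1 isT n1)).
    - by apply: adj_row; rewrite eq_sym.
    - by rewrite -ordS_inord //; apply: adj_ordS.
    - by rewrite xpair_eqE (negbTE cd) andbF.
  have [-> //|jc] := eqVneq j c; have [-> //|jd] := eqVneq j d.
  apply: (two _ _ _ cY dY); [exact: adj_row|exact: adj_row|].
  by rewrite xpair_eqE (negbTE cd) andbF.
have next i : i < n -> (forall j, (inord i, j) \in Y) ->
    (inord i.+1, d) \in Y -> forall j, (inord i.+1, j) \in Y.
  move=> lt rowi dY j; have [-> //|jd] := eqVneq j d.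
  apply: (two _ _ _ dY (rowi j)); first exact: adj_row.
    by rewrite -(ord_pred_inordS lt); apply: adj_ord_pred.
  by rewrite xpair_eqE [d == j]eq_sym (negbTE jd) andbF.
(* Keeping [k] abstract covers both row [i.+2] and the wrap-around from row [n] to row [0]. *)
have between i j k : i < n -> k = ordS (inord i.+1) -> inord i != k ->
    (inord i, j) \in Y -> (k, j) \in Y -> (inord i.+1, j) \in Y.
  move=> lt -> ne iY kY; apply: (two _ _ _ iY kY).
  - by rewrite -(ord_pred_inordS lt); apply: adj_ord_pred.
  - exact: adj_ordS.
  - by rewrite xpair_eqE (negbTE ne).
have rows i : i <= n -> forall j, (inord i, j) \in Y.
  elim: i => [|i IH] lt; first exact: row0.
  have {}IH := IH (ltnW lt).
  case: (boolP (odd i)) => oi; last by apply: next => //; apply: seed.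
  (* Row [i.+1] is even. If it is the last row, it lies between the full rows [i] and [0]; otherwise
     the seed in row [i.+2] first yields its vertex in column [d], and [next] fills the rest. *)
  move: lt; rewrite leq_eqVlt => /predU1P[iE|lt2].
    move=> j; apply: (between i j (inord 0)) => //; first by rewrite iE.
      by apply: val_inj; rewrite /= !inordK ?iE ?modnn.
    rewrite -val_eqE /= !inordK //; [by case: (i) oi|by rewrite -iE; lia].
  apply: next => //; [exact: ltnW|].
  apply: (between i d (inord i.+2)) => //; [exact: ltnW|by rewrite ordS_inord| |].
    by rewrite -val_eqE /= !inordK //; lia.
  by apply: seed => //=; rewrite oi.
apply/setP=> -[i j]; rewrite in_setT -[i]inord_val; apply: rows.
by rewrite -ltnS.
Qed.

End UpperBound.

Theorem theorem6 (n : nat) (hn : 3 <= n) :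
  dyn (cart_prod (@cycle_graph n) (@complete_graph n)) (fun _ => 2) = n %/ 2 + 1.
Proof.
case: n hn => // n hn.
have [[D monD DE] minD] :=
  dynP (cart_prod (@cycle_graph n.+1) (@complete_graph n.+1)) (fun=> 2).
have n1 : 0 < n by lia.
have cd : ord0 != ord_max :> 'I_n.+1 by rewrite -val_eqE /=; lia.
have lower := dynamic_monopoly_cycle_complete_card monD isT (ltnW hn).
have upper := minD _ (dynamic_monopoly_odd_row_seeds n1 cd).
have card_seeds := card_odd_row_seeds n (ord0 : 'I_n.+1) ord_max.
apply/eqP; rewrite eqn_leq divn2 (leq_trans upper card_seeds) -DE andTb.
(* The strict bound [n.+1 < 2 * #|D|] gives the extra 1 when the number of rows is even. *)
by move: #|D| lower => x; lia.
Qed.
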